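(* Every subcubic graph $G$ with $\mathrm{mad}(G) < \frac{9}{4}$ is $(1,2^4)$-packing edge-colorable.
   Context: Graphs are finite and simple. A graph is subcubic if its maximum degree is at most $3$. $\mathrm{mad}(G)$ denotes the maximum average degree, i.e., the maximum of $2|E(H)|/|V(H)|$ over all nonempty subgraphs $H$ of $G$. For distinct edges $e,f$ of $G$, the distance between $e$ and $f$ is the distance between the corresponding vertices of the line graph $L(G)$ (so edges sharing an endpoint are at distance $1$). A graph $G$ is $(1,2^4)$-packing edge-colorable if $E(G)$ can be partitioned into five classes (possibly empty) such that in the first class any two distinct edges are at distance at least $2$ (the class is a matching), and in each of the remaining four classes any two distinct edges are at distance at least $3$ (the class is an induced matching). *)

(* Defs.v *)
From HB Require Import structures.
From mathcomp Require Import all_boot all_order all_algebra.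

Set Implicit Arguments.
Unset Strict Implicit.
Unset Printing Implicit Defensive.

Import Order.TTheory GRing.Theory Num.Theory.

Record sgraph := SGraph {
  vertex :> finType;
  adj : rel vertex;
  adj_sym : symmetric adj;
  adj_irrefl : irreflexive adj
}.

Definition edges (G : sgraph) : {set {set G}} :=
  [set [set p.1; p.2] | p in [pred p : G * G | adj p.1 p.2]].

Definition degree (G : sgraph) (x : G) : nat := #|[set y | adj x y]|.

Definition max_degree (G : sgraph) : nat := \max_(x : G) degree x.

Definition subcubic (G : sgraph) : bool := max_degree G <= 3.

(* A subgraph is given by its vertex set and its edge set; it need not be     *)
(* induced.                                                                   *)
Definition is_subgraph (G : sgraph) (H : {set G} * {set {set G}}) : bool :=
  (H.2 \subset edges G) && [forall f in H.2, f \subset H.1].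

(* The ratios are nonnegative, so the default value 0 only matters for the    *)
(* graph without vertices.                                                    *)
Definition mad (G : sgraph) : rat :=
  (\big[Num.max/0]_(H : {set G} * {set {set G}} |
      is_subgraph H && (H.1 != set0)) ((2 * #|H.2|)%N%:R / #|H.1|%:R))%R.

Definition walk_of_length (G : sgraph) (x y : G) (n : nat) : bool :=
  [exists p : n.-tuple G, path (@adj G) x p && (last x p == y)].

Lemma walkP (G : sgraph) (x y : G) :
  reflect (exists n, walk_of_length x y n) (connect (@adj G) x y).
Proof.
apply: (iffP connectP) => [[p xp ->] | [n /existsP[p /andP[xp /eqP <-]]]].
  by exists (size p); apply/existsP; exists (in_tuple p); rewrite xp eqxx.
by exists p.
Qed.

(* None stands for an infinite distance (distinct connected components).      *)
Definition dist (G : sgraph) (x y : G) : option nat :=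
  match walkP x y with
  | ReflectT xy => Some (ex_minn xy)
  | ReflectF _ => None
  end.

Definition dist_at_least (G : sgraph) (d : nat) (x y : G) : bool :=
  if dist x y is Some n then d <= n else true.

Definition edge (G : sgraph) : finType := {f : {set G} | f \in edges G}.

Definition line_adj (G : sgraph) : rel (edge G) :=
  [rel f g | (f != g) && (val f :&: val g != set0)].

Lemma line_adj_sym (G : sgraph) : symmetric (@line_adj G).
Proof. by move=> f g; rewrite /line_adj /= eq_sym setIC. Qed.

Lemma line_adj_irrefl (G : sgraph) : irreflexive (@line_adj G).
Proof. by move=> f; rewrite /line_adj /= eqxx. Qed.

Definition line_graph (G : sgraph) : sgraph :=
  SGraph (@line_adj_sym G) (@line_adj_irrefl G).

(* For s = (s_0, ..., s_(k-1)), the edges are partitioned into k possibly     *)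
(* empty classes, the fibres of c, and distinct edges of the i-th class are   *)
(* at distance at least s_i + 1 in the line graph.                            *)
Definition packing_edge_colorable (s : seq nat) (G : sgraph) : Prop :=
  exists c : line_graph G -> 'I_(size s),
    forall f g : line_graph G, f != g -> c f = c g ->
      dist_at_least (nth 0 s (c f)).+1 f g.

(* Main.v *)
(* Call class 0 the matching and let every vertex see exactly three colours,  *)
(* its palette, as if pendant half-edges completed it to degree three. Then a *)
(* proper colouring is valid iff the palettes of any two adjacent vertices    *)
(* meet only in 0 and in the colour of their common edge. This condition is   *)
(* local, so a colouring of an induced subgraph G[A] extends one vertex at a  *)
(* time, and the induction is on A. Vertices of degree at most one are always *)
(* added. If G[A] has n2 vertices of degree two, n3 of degree three and no    *)
(* others, mad < 9/4 gives 3 n3 < n2; distributing every vertex of degree two *)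
(* to the two ends of the path of such vertices through it, one finds a path  *)
(* of four vertices of degree two, or a vertex of degree three from which     *)
(* start three such paths with at least 3, 2 and 1 vertices. Either           *)
(* configuration, possibly closing up to a cycle of length three or four, can *)
(* be removed and coloured back: the colours and palettes that may arrive at  *)
(* the end of a path of given length form a finite transfer relation.         *)

Require Import Defs.
From mathcomp Require Import all_boot all_order all_algebra zify.

Set Implicit Arguments.
Unset Strict Implicit.
Unset Printing Implicit Defensive.

(** With palettes, the distance condition becomes a condition on single edges: a nonzero colour seen
    at both ends of an edge must be the colour of that edge ([coloring_packing]). What a coloured
    part imposes on the rest is then carried by states, a state being the palette of a boundary
    vertex together with the colour of an edge leaving it. There are only thirty states, so whether
    a chain of vertices of degree two can join two given ones is a finite question, settled by
    evaluation. The decisive fact is [can3]: a chain of three vertices leads from any state to any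
    palette containing 0, through any nonzero colour of it.

    Let every proper subset of [B] be colourable and let [G[B]] have minimum degree at least two.
    Four consecutive vertices of degree two ([path4_colorable]), or a vertex of degree three with
    legs of at least 3, 2 and 1 vertices of degree two ([legs_colorable]), can be deleted and
    coloured back. If neither occurs, walk backwards along each of the [2 * n2] darts ending at a
    vertex of degree two: a vertex of degree three is met within three steps ([deg2_darts_cover]),
    and each of these accounts for at most six darts ([leg_count]). Hence [n2 <= 3 * n3], so the
    average degree of [G[B]] is at least 9/4, against the bound on [mad]. *)

(** * Palettes and the finite transfer relation along chains of degree-two vertices *)

Definition palettes : seq (seq nat) :=
  [:: [:: 0; 1; 2]; [:: 0; 1; 3]; [:: 0; 1; 4]; [:: 0; 2; 3]; [:: 0; 2; 4];
      [:: 0; 3; 4]; [:: 1; 2; 3]; [:: 1; 2; 4]; [:: 1; 3; 4]; [:: 2; 3; 4]].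

Lemma palettesP p : p \in palettes -> size p = 3 /\ uniq p.
Proof.
have: all (fun p => (size p == 3) && uniq p) palettes by [].
by move=> /allP h /h /andP[/eqP].
Qed.

Lemma palettes_lt5 p a : p \in palettes -> a \in p -> a < 5.
Proof.
have: all (all (fun a => a < 5)) palettes by [].
by move=> /allP h /h /allP; apply.
Qed.

Definition compatible (p q : seq nat) (h : nat) : bool :=
  [&& h \in p, h \in q & all (fun a => (a \in q) ==> (a == 0) || (a == h)) p].

Lemma compatible_sym p q h : compatible p q h = compatible q p h.
Proof.
rewrite /compatible andbCA; congr [&& _, _ & _].
by apply/allP/allP => hall a a1; apply/implyP => a2;
  move: (hall a a2); rewrite a1.
Qed.

(* Walking from an edge coloured h at a vertex with palette p through n       *)
(* vertices of degree two, one may leave the last one by an edge of colour k  *)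
(* towards a vertex with palette q.                                           *)
Fixpoint can (n : nat) (p : seq nat) (h : nat) (q : seq nat) (k : nat) : bool :=
  if n is n'.+1 then
    has (fun p' => has (fun h' => can n' p' h' q k) [seq h' <- p' | h' != h])
      [seq p' <- palettes | compatible p p' h]
  else if h == k then compatible p q h else false.

Lemma canS n p h q k : can n.+1 p h q k -> exists p' h',
  [/\ p' \in palettes, compatible p p' h, (h' \in p') && (h' != h)
    & can n p' h' q k].
Proof.
case/hasP=> p'; rewrite mem_filter => /andP[cp pP] /hasP[h'].
by rewrite mem_filter andbC => hh hc; exists p', h'.
Qed.

(** Boolean quantification over all states, so that the finite claims below are decided by
    computation. *)
Definition states (f : seq nat -> nat -> bool) : bool :=
  all (fun p => all (f p) p) palettes.

Lemma statesP f p h : states f -> p \in palettes -> h \in p -> f p h.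
Proof. by move=> /allP hf /hf /allP; apply. Qed.

(** Three vertices are enough for the chain to forget its starting state; the only restriction left
    is at the far end. *)
Lemma can3 p h q g : p \in palettes -> h \in p -> q \in palettes -> g \in q ->
  0 \in q -> g != 0 -> can 3 p h q g.
Proof.
move=> hp hh hq hg q0 g0.
have/statesP/(_ hp hh)/statesP/(_ hq hg): states (fun p h => states (fun q g =>
  (0 \in q) && (g != 0) ==> can 3 p h q g)) by lazy.
by rewrite q0 g0.
Qed.

(** The two short legs govern the palette [q] of the centre. The leg with three vertices only asks
    for the hypotheses of [can3], which is why its own starting state does not appear. *)
Lemma spider_state p2 h2 p3 h3 :
  p2 \in palettes -> h2 \in p2 -> p3 \in palettes -> h3 \in p3 ->
  exists q g h k, [/\ q \in palettes, [&& g \in q, h \in q & k \in q],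
    uniq [:: g; h; k], (0 \in q) && (g != 0) & can 2 p2 h2 q h && can 1 p3 h3 q k].
Proof.
move=> p2P h2P p3P h3P.
have/statesP/(_ p2P h2P)/statesP/(_ p3P h3P):
  states (fun p2 h2 => states (fun p3 h3 =>
  has (fun q => (0 \in q) && has (fun k => can 1 p3 h3 q k &&
  has (fun h => (h != k) && has (fun g => [&& g != 0, g != h & g != k] && can 2 p2 h2 q h) q) q) q)
    palettes)) by lazy.
case/hasP=> q qP /andP[q0 /hasP[k kq /andP[ck /hasP[h hq /andP[hk /hasP[g gq]]]]]].
case/andP=> /and3P[g0 gh gk] ch.
exists q, g, h, k; split; rewrite ?gq ?hq ?kq ?q0 ?ch //.
by rewrite /= !inE negb_or gh gk hk.
Qed.

(** Chooses the palette of the last of four path vertices: it fits the nearby end and leaves [can3]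
    applicable to the other three. *)
Lemma path_state p h : p \in palettes -> h \in p ->
  exists q g, [/\ q \in palettes, (g \in q) && (g != h), (0 \in q) && (g != 0)
    & can 0 p h q h].
Proof.
move=> pP hP.
have/statesP/(_ pP hP): states (fun p h =>
  has (fun q => has (fun g => [&& g != h, 0 \in q, g != 0 & can 0 p h q h]) q) palettes)
  by lazy.
case/hasP=> q qP /hasP[g gq /and4P[gh q0 g0 ch]].
by exists q, g; rewrite gq gh q0 g0.
Qed.

(** For a cycle of length [n + 2] through a vertex of palette [p], left by an edge coloured 0 and
    re-entered by one coloured [b]. *)
Lemma loop_state n p b : n \in [:: 1; 2] -> p \in palettes -> b \in p ->
  0 \in p -> b != 0 ->
  exists q g, [/\ q \in palettes, (g \in q) && (g != b), can n p 0 q g & can 0 p b q b].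
Proof.
move=> nP pP bP p0 b0.
have/allP/(_ n nP)/statesP/(_ pP bP): all (fun n => states (fun p b =>
  (0 \in p) && (b != 0) ==>
  has (fun q => has (fun g => [&& g != b, can n p 0 q g & can 0 p b q b]) q) palettes))
  [:: 1; 2] by lazy.
rewrite p0 b0 => /hasP[q qP /hasP[g gq /and3P[gb cg cb]]].
by exists q, g; rewrite gq gb.
Qed.

(** Crossing one vertex of degree two, one can reach a branch vertex whose two remaining edges carry
    0 and a nonzero [b], as [loop_state] requires. *)
Lemma stem_state p h : p \in palettes -> h \in p ->
  exists q g b, [/\ q \in palettes, [&& g \in q, 0 \in q & b \in q],
    uniq [:: g; 0; b] & can 1 p h q g].
Proof.
move=> pP hP.
have/statesP/(_ pP hP): states (fun p h =>
  has (fun q => has (fun g => has (fun b =>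
    [&& 0 \in q, uniq [:: g; 0; b] & can 1 p h q g]) q) q) palettes)
  by lazy.
case/hasP=> q qP /hasP[g gq /hasP[b bq /and3P[q0 u c1]]].
by exists q, g, b; rewrite gq bq q0.
Qed.

Lemma pendant_state p h : p \in palettes -> h \in p ->
  exists2 q, q \in palettes & compatible p q h.
Proof.
move=> pP hP.
have/statesP/(_ pP hP)/hasP: states (fun p h =>
  has (fun q => compatible p q h) palettes) by lazy.
by [].
Qed.

(** * Partial colourings and their extension by a vertex or a leg *)

Section Coloring.

Variable G : sgraph.
Hypothesis degree_le3 : forall x : G, degree x <= 3.
Implicit Types (A B : {set G}) (x y z e t : G) (P : G -> seq nat) (c : G -> G -> nat).

(* P x lists the three colours seen by x, some of which may be carried by no  *)
(* edge, and c x y is the colour of the edge xy as seen from x. It is defined *)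
(* also for neighbours y outside A, so that the edges leaving A are already   *)
(* precoloured when a vertex is added to A. The condition on palettes says    *)
(* that the nonzero classes are induced matchings.                            *)
Definition coloring A P c : Prop :=
  (forall x, x \in A -> [/\ P x \in palettes, {in adj x &, injective (c x)} &
     forall y, adj x y -> c x y \in P x]) /\
  (forall x y, x \in A -> y \in A -> adj x y ->
     c x y = c y x /\ compatible (P x) (P y) (c x y)).

Definition colorable A : Prop := exists P c, coloring A P c.

Definition agree A P c P' c' : Prop :=
  forall y, y \in A -> P' y = P y /\ c' y = c y.

Lemma agree_trans A B P1 c1 P2 c2 P3 c3 : A \subset B ->
  agree A P1 c1 P2 c2 -> agree B P2 c2 P3 c3 -> agree A P1 c1 P3 c3.
Proof.
move=> /subsetP sAB h12 h23 y yA.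
by have [-> ->] := h23 y (sAB y yA); apply: h12.
Qed.

(** As the degree is at most three, neighbours do not outnumber the colours of [q]. Both are listed
    with the prescribed pairs first and matched by position. *)
Lemma assign_colors x (l : seq (G * nat)) q :
  q \in palettes -> uniq (unzip1 l) -> uniq (unzip2 l) ->
  {in l, forall yk, adj x yk.1 /\ yk.2 \in q} ->
  exists f : G -> nat, [/\ {in adj x &, injective f},
    forall y, adj x y -> f y \in q & {in l, forall yk, f yk.1 = yk.2}].
Proof.
move=> /palettesP[sq uq] u1 u2 hl.
pose N := enum [set y | adj x y].
have NE y : (y \in N) = adj x y by rewrite mem_enum inE.
pose r := unzip1 l ++ [seq y <- N | y \notin unzip1 l].
pose s := unzip2 l ++ [seq k <- q | k \notin unzip2 l].
have ur : uniq r.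
  rewrite cat_uniq u1 filter_uniq ?enum_uniq // andbT.
  by apply/hasPn => y; rewrite mem_filter => /andP[].
have us : uniq s.
  rewrite cat_uniq u2 filter_uniq // andbT.
  by apply/hasPn => y; rewrite mem_filter => /andP[].
have rE : r =i N.
  move=> y; rewrite mem_cat mem_filter; case: (boolP (y \in unzip1 l)) => //=.
  by case/mapP => yk /hl[h _] ->; rewrite NE h.
have sE : s =i q.
  move=> y; rewrite mem_cat mem_filter; case: (boolP (y \in unzip2 l)) => //=.
  by case/mapP => yk /hl[_ h] ->; rewrite h.
have sr : size r <= 3.
  by rewrite (perm_size (uniq_perm ur (enum_uniq _) rE)) -cardE degree_le3.
have ss : size s = 3 by rewrite (perm_size (uniq_perm us uq sE)).
have ix y : adj x y -> index y r < size s.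
  by rewrite -NE -rE -index_mem ss => h; apply: leq_trans h sr.
exists (fun y => nth 0 s (index y r)); split.
- move=> y z ya za /eqP; rewrite nth_uniq ?ix // => /eqP.
  by move/(index_inj y); rewrite !rE !NE; apply.
- by move=> y ya; rewrite -sE mem_nth ?ix.
case=> y k yk /=.
have yl : y \in unzip1 l by apply/mapP; exists (y, k).
have il : index (y, k) l < size l by rewrite index_mem.
have -> : index y r = index (y, k) l.
  rewrite index_cat yl -{1}(index_uniq y _ u1 (i := index (y, k) l)) ?size_map //.
  by rewrite (nth_map (y, k)) // nth_index.
by rewrite nth_cat size_map il (nth_map (y, k)) // nth_index.
Qed.

(** Edges back to [A] must keep the colour already chosen at their other end. The list [l] may also
    prescribe colours towards vertices still to come; the rest is filled in freely. *)
Lemma color_vertex A P c x (l : seq (G * nat)) q :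
  coloring A P c -> x \notin A -> q \in palettes ->
  uniq (unzip1 l) -> uniq (unzip2 l) ->
  {in l, forall yk, adj x yk.1 /\ yk.2 \in q} ->
  {in l, forall yk, yk.1 \in A ->
     yk.2 = c yk.1 x /\ compatible (P yk.1) q yk.2} ->
  (forall y, y \in A -> adj x y -> y \in unzip1 l) ->
  exists P' c', [/\ coloring (x |: A) P' c', agree A P c P' c', P' x = q
    & {in l, forall yk, c' x yk.1 = yk.2}].
Proof.
move=> [c1 c2] xA qP u1 u2 hl hA hN.
have [f [fi fq fl]] := assign_colors qP u1 u2 hl.
have neq y : y \in A -> (y == x) = false.
  by move=> yA; apply: contraNF xA => /eqP <-.
have key y : y \in A -> adj x y -> f y = c y x /\ compatible (P y) q (f y).
  move=> yA xy; have /mapP[yk ykl yE] := hN y yA xy.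
  by move: yA; rewrite yE (fl _ ykl); apply: hA.
exists (fun y => if y == x then q else P y), (fun y => if y == x then f else c y).
split; rewrite /= ?eqxx //; last by move=> y yA /=; rewrite neq.
split=> [y | y z].
  by rewrite in_setU1 /=; case: eqVneq => [-> _ |_ /= /c1].
rewrite !in_setU1 /=; case: (eqVneq y x) => [->|_] /=; case: (eqVneq z x) => [->|_] //=.
- by rewrite adj_irrefl.
- by move=> _ zA xz; have [-> h] := key z zA xz; rewrite compatible_sym.
- by move=> yA _; rewrite adj_sym => xy; have [-> h] := key y yA xy.
exact: c2.
Qed.

Definition nbrs B x : {set G} := [set y in B | adj x y].

Fixpoint is_leg B e (ts : seq G) x : bool :=
  if ts is t :: ts' then
    [&& e != head x ts', nbrs B t == [set e; head x ts'] & is_leg B t ts' x]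
  else true.

(** Each unfolding of [can] colours one vertex. The vertex [x] stays uncoloured, and [q] and [k]
    only announce what it will receive, so that several legs can be coloured before their common
    end. *)
Lemma leg_extend B x q k ts A P c e :
  coloring A P c -> A \subset B -> e \in A -> is_leg B e ts x ->
  uniq (x :: ts) -> {subset ts <= B} -> {in x :: ts, forall t, t \notin A} ->
  can (size ts) (P e) (c e (head x ts)) q k ->
  exists P' c', [/\ coloring (A :|: [set:: ts]) P' c', agree A P c P' c',
    compatible (P' (last e ts)) q k & c' (last e ts) x = k].
Proof.
elim: ts A P c e => [|t ts IH] A P c e cA AB eA.
  rewrite /= => _ _ _ _; case: eqP => // <- ?; exists P, c; split=> //.
  by rewrite set_nil setU0.
case/and3P => en /eqP Nt leg /and3P[xt tts uts] tsB tsA.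
case/canS=> p [h' [pP cp /andP[h'p h'h] can']].
move: xt; rewrite inE negb_or => /andP[xt xts].
have tA : t \notin A by apply: tsA; rewrite !inE eqxx orbT.
have tB : t \in B by apply: tsB; rewrite inE eqxx.
have nA : head x ts \notin A.
  by apply: tsA; case: (ts) => [|y s]; rewrite /= !inE eqxx ?orbT.
have NtE y : (y \in B) && adj t y = (y == e) || (y == head x ts).
  by move/setP/(_ y): Nt; rewrite !inE.
have te : adj t e by have := NtE e; rewrite eqxx => /andP[].
have tn : adj t (head x ts).
  by have := NtE (head x ts); rewrite eqxx orbT => /andP[].
have [hp hp'] : c e t \in P e /\ c e t \in p by case/and3P: cp.
have [|||||P1 [c1 [cA1 ag1 P1t c1t]]] := color_vertex (x := t)
  (l := [:: (e, c e t); (head x ts, h')]) (q := p) cA tA pP.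
- by rewrite /= inE en.
- by rewrite /= inE eq_sym h'h.
- by move=> yk; rewrite !inE => /orP[]/eqP -> /=.
- by move=> yk; rewrite !inE => /orP[]/eqP -> //=; rewrite (negPf nA).
- by move=> y yA ty; have := NtE y; rewrite ty (subsetP AB) // !inE.
have c1h : c1 t (head x ts) = h'.
  by apply: (c1t (head x ts, h')); rewrite !inE eqxx orbT.
have [|||||||P2 [c2 [cA2 ag2 cpl cl]]] := IH (t |: A) P1 c1 t cA1.
- by rewrite subUset sub1set tB.
- by rewrite setU11.
- exact: leg.
- by apply/andP.
- by move=> y yts; apply: tsB; rewrite inE yts orbT.
- move=> y yts; rewrite in_setU1 negb_or; apply/andP; split.
    by apply: contraNneq tts => yt; move: yts; rewrite yt inE eq_sym (negPf xt).
  by apply: tsA; move: yts; rewrite !inE orbCA => ->; rewrite orbT.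
- by rewrite P1t c1h.
exists P2, c2; split=> //.
  by rewrite set_cons setUCA setUA.
by apply: agree_trans ag1 ag2; rewrite subsetUr.
Qed.

End Coloring.

(** * Pendant vertices, closed paths, short cycles and lollipops *)

Section Reductions.

Variable G : sgraph.
Hypothesis degree_le3 : forall x : G, degree x <= 3.
Implicit Types (A B : {set G}) (x y z e t u : G) (P : G -> seq nat) (c : G -> G -> nat).

Lemma in_nbrs B x y : (y \in nbrs B x) = (y \in B) && adj x y.
Proof. by rewrite inE. Qed.

Lemma coloringP A P c x y : coloring A P c -> x \in A -> adj x y ->
  P x \in palettes /\ c x y \in P x.
Proof. by case=> h _ /h[? _ hc] /hc. Qed.

Lemma set0_colorable : colorable (set0 : {set G}).
Proof. by exists (fun=> [::]), (fun _ _ => 0); split=> x; rewrite inE. Qed.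

Lemma pendant_colorable B x : x \in B -> #|nbrs B x| <= 1 ->
  colorable (B :\ x) -> colorable B.
Proof.
move=> xB Nx [P [c cA]].
have xA : x \notin B :\ x by rewrite setD11.
suff [l [q [qP u hl hA hN]]] : exists l q, [/\ q \in palettes,
    uniq (unzip1 l) /\ uniq (unzip2 l),
    {in l, forall yk, adj x yk.1 /\ yk.2 \in q},
    {in l, forall yk, yk.1 \in B :\ x ->
     yk.2 = c yk.1 x /\ compatible (P yk.1) q yk.2}
    & (forall y, y \in B :\ x -> adj x y -> y \in unzip1 l)].
  have [P' [c' [cP' _ _ _]]] :=
    color_vertex degree_le3 cA xA qP u.1 u.2 hl hA hN.
  by exists P', c'; rewrite -(setD1K xB).
case: (pickP [in nbrs B x]) => [y yN|N0]; last first.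
  exists [::], [:: 0; 1; 2]; split=> // y; rewrite in_setD1 => /andP[_ yB] xy.
  by have := N0 y; rewrite /= in_nbrs yB xy.
have /andP[yB xy] : (y \in B) && adj x y by rewrite -in_nbrs.
have yA : y \in B :\ x.
  by rewrite in_setD1 yB andbT; apply: contraTneq xy => ->; rewrite adj_irrefl.
have yx : adj y x by rewrite adj_sym.
have [Py cy] := coloringP cA yA yx.
have [q qP cq] := pendant_state Py cy.
exists [:: (y, c y x)], q; split=> //.
- by move=> yk; rewrite inE => /eqP -> /=; split=> //; case/and3P: cq.
- by move=> yk; rewrite inE => /eqP -> /=.
move=> z; rewrite in_setD1 => /andP[_ zB] xz; rewrite inE /=; apply/eqP.
by apply: (card_le1_eqP Nx) => //; rewrite in_nbrs zB.
Qed.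

(** The ends [e1] and [e2] may coincide, so this also closes cycles. *)
Lemma close_path B A P c e1 e2 ts x q g :
  coloring A P c -> A = B :\: [set:: x :: ts] -> e1 \in A -> e2 \in A ->
  is_leg B e1 ts x -> uniq (x :: ts) -> {subset x :: ts <= B} ->
  nbrs B x = [set last e1 ts; e2] -> last e1 ts != e2 ->
  q \in palettes -> (g \in q) && (g != c e2 x) ->
  can (size ts) (P e1) (c e1 (head x ts)) q g -> can 0 (P e2) (c e2 x) q (c e2 x) ->
  colorable B.
Proof.
move=> cA AE e1A e2A leg ut tsB Nx ne qP /andP[gq gne] can1 can2.
have AB : A \subset B by rewrite AE subsetDl.
have nA : {in x :: ts, forall t, t \notin A}.
  by move=> t tx; rewrite AE in_setD inE tx.
have tB : {subset ts <= B} by move=> t tt; apply: tsB; rewrite inE tt orbT.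
have [P1 [c1 [cA1 ag cp ce]]] := leg_extend degree_le3 cA AB e1A leg ut tB nA can1.
have NxE y : (y \in B) && adj x y = (y == last e1 ts) || (y == e2).
  by rewrite -in_nbrs Nx !inE.
have [_ xa1] : last e1 ts \in B /\ adj x (last e1 ts).
  by apply/andP; rewrite NxE eqxx.
have [_ xa2] : e2 \in B /\ adj x e2 by apply/andP; rewrite NxE eqxx orbT.
have cp2 : compatible (P e2) q (c e2 x) by move: can2; rewrite /can eqxx.
have [P2e c2e] := ag e2 e2A.
have xA1 : x \notin A :|: [set:: ts].
  rewrite inE negb_or nA ?inE ?eqxx //=.
  by case/andP: ut.
have [|||||P' [c' [cP' _ _ _]]] := color_vertex degree_le3 (x := x)
  (l := [:: (last e1 ts, g); (e2, c e2 x)]) (q := q) cA1 xA1 qP.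
- by rewrite /= inE ne.
- by rewrite /= inE gne.
- by move=> yk; rewrite !inE => /orP[]/eqP -> //=; split=> //; case/and3P: cp2.
- by move=> yk; rewrite !inE => /orP[]/eqP -> //= _; rewrite ?ce ?P2e ?c2e.
- move=> y yA xy; rewrite !inE -NxE xy andbT.
  by move: yA; rewrite inE => /orP[/(subsetP AB)//|]; rewrite inE => /tB.
exists P', c'; suff <- : x |: (A :|: [set:: ts]) = B by [].
rewrite setUCA -set_cons AE setUC; apply/setP => y; rewrite !in_setU in_setD.
rewrite inE; case: (boolP (y \in x :: ts)) => //= /tsB -> //.
Qed.

Lemma close_loop B A P c x ts u :
  coloring A P c -> A = B :\: [set:: u :: ts] -> x \in A ->
  size ts \in [:: 1; 2] ->
  is_leg B x ts u -> uniq (u :: ts) -> {subset u :: ts <= B} ->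
  nbrs B u = [set last x ts; x] -> last x ts != x -> adj x u ->
  0 \in P x -> c x (head u ts) = 0 -> c x u != 0 -> colorable B.
Proof.
move=> cA AE xA sz leg ut tB Nu ne xu P0 c0 cn0.
have [Px cxu] := coloringP cA xA xu.
have [q [g [qP gq can1 can2]]] := loop_state sz Px cxu P0 cn0.
by apply: (close_path (g := g) cA AE xA xA leg ut tB Nu ne qP gq) => //; rewrite c0.
Qed.

(** All these vertices have degree two, so the cycle is a component of [G[B]] and [x] can be
    coloured at will. *)
Lemma cycle_colorable B x ts u :
  size ts \in [:: 1; 2] -> uniq [:: x, u & ts] -> {subset [:: x, u & ts] <= B} ->
  is_leg B x ts u -> nbrs B u = [set last x ts; x] ->
  nbrs B x = [set head u ts; u] ->
  colorable (B :\: [set:: [:: x, u & ts]]) -> colorable B.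
Proof.
move=> sz uq sB leg Nu Nx [P [c cA]].
move: cA; move AE: (B :\: _) => A cA.
have NxE y : (y \in B) && adj x y = (y == head u ts) || (y == u).
  by rewrite -in_nbrs Nx !inE.
have [_ xa1] : head u ts \in B /\ adj x (head u ts).
  by apply/andP; rewrite NxE eqxx.
have [_ xa2] : u \in B /\ adj x u by apply/andP; rewrite NxE eqxx orbT.
have nA y : y \in [:: x, u & ts] -> y \notin A by move=> yi; rewrite -AE in_setD inE yi.
have hts : head u ts \in ts.
  by case: (ts) sz => [|t s] //= _; rewrite inE eqxx.
have lts : last x ts \in ts.
  by case: (ts) sz => [|t s] //= _; rewrite mem_last.
have [xn un] : x \notin u :: ts /\ u \notin ts by case/and3P: uq.
have xA := nA x (mem_head _ _).
have hA : head u ts \notin A by apply: nA; rewrite !inE hts !orbT.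
have uA : u \notin A by apply: nA; rewrite !inE eqxx !orbT.
(* Colours 0 and 1 at [x] create the situation of [close_loop]. *)
have [|||||P' [c' [cP' _ Px cx]]] := color_vertex degree_le3 (x := x)
  (l := [:: (head u ts, 0); (u, 1)]) (q := [:: 0; 1; 2]) cA xA isT.
- by rewrite /= inE andbT; apply: contraNneq un => <-.
- by [].
- by move=> yk; rewrite !inE => /orP[]/eqP ->.
- by move=> yk; rewrite !inE => /orP[]/eqP -> /=; rewrite ?(negPf hA) ?(negPf uA).
- move=> y; rewrite -AE in_setD => /andP[_ yB] xy.
  by rewrite !inE -NxE yB.
apply: (close_loop (x := x) (u := u) (ts := ts) cP').
- apply/setP => y; rewrite -AE !(in_setU1, in_setD) inE [y \in x :: _]inE negb_or.
  case: (eqVneq y x) => [->|yx] /=; last by rewrite in_set.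
  by rewrite in_set xn sB ?mem_head.
- by rewrite setU11.
- by [].
- by [].
- by case/andP: uq.
- by move=> y yi; apply: sB; rewrite inE yi orbT.
- by [].
- by apply: contraNneq xn => <-; rewrite inE lts orbT.
- by [].
- by rewrite Px.
- by apply: (cx (_, _)); rewrite !inE eqxx.
- by rewrite (cx (u, 1)) ?inE ?eqxx ?orbT.
Qed.

(** A cycle of length three or four attached at [x] to a stem vertex [y] of degree two: colour [y],
    then [x] by [stem_state], then the cycle by [close_loop]. *)
Lemma lollipop_colorable B x y z ts u :
  size ts \in [:: 1; 2] -> uniq [:: y, x, u & ts] ->
  {subset [:: y, x, u & ts] <= B} ->
  is_leg B x ts u -> nbrs B u = [set last x ts; x] ->
  nbrs B x = [set y; head u ts; u] -> nbrs B y = [set z; x] ->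
  z != x -> z \notin [:: y, x, u & ts] ->
  colorable (B :\: [set:: [:: y, x, u & ts]]) -> colorable B.
Proof.
move=> sz uq sB leg Nu Nx Ny zx zn [P [c cA]].
move: cA; move AE: (B :\: _) => A cA.
have NxE t : (t \in B) && adj x t = [|| t == y, t == head u ts | t == u].
  by rewrite -in_nbrs Nx !inE orbA.
have [_ xa1] : head u ts \in B /\ adj x (head u ts).
  by apply/andP; rewrite NxE eqxx orbT.
have [_ xa2] : u \in B /\ adj x u by apply/andP; rewrite NxE eqxx !orbT.
have [_ xa3] : y \in B /\ adj x y by apply/andP; rewrite NxE eqxx.
have nA t : t \in [:: y, x, u & ts] -> t \notin A by move=> ti; rewrite -AE in_setD inE ti.
have hts : head u ts \in ts.
  by case: (ts) sz => [|t s] //= _; rewrite inE eqxx.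
have lts : last x ts \in ts.
  by case: (ts) sz => [|t s] //= _; rewrite mem_last.
have [yn xn un] : [/\ y \notin [:: x, u & ts], x \notin u :: ts & u \notin ts].
  by case/and4P: uq.
have AB : A \subset B by rewrite -AE subsetDl.
have [zB yz] : z \in B /\ adj y z.
  by apply/andP; rewrite -in_nbrs Ny !inE eqxx.
have zA : z \in A by rewrite -AE in_setD inE zn.
have zy : adj z y by rewrite adj_sym.
have [Pz cz] := coloringP cA zA zy.
have [q [g [b [qP /and3P[gq q0 bq] uq3 can1]]]] := stem_state Pz cz.
have yx : y != x by move: yn; rewrite inE negb_or => /andP[].
have [||||P1 [c1 [cA1 ag cp ce]]] :=
    leg_extend degree_le3 (x := x) (ts := [:: y]) cA AB zA _ _ _ _ can1.
- by rewrite /= Ny zx eqxx.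
- by rewrite /= inE eq_sym yx.
- by move=> t; rewrite inE => /eqP ->; rewrite sB ?mem_head.
- by move=> t ti; apply: nA; move: ti; rewrite !inE => /orP[]->; rewrite ?orbT.
have A1E t : (t \in A :|: [set:: [:: y]]) = (t \in A) || (t == y) by rewrite !inE.
have xA1 : x \notin A :|: [set:: [:: y]].
  by rewrite A1E negb_or eq_sym yx nA // !inE eqxx orbT.
have hA : head u ts \in A :|: [set:: [:: y]] = false.
  apply: negbTE; rewrite A1E negb_or nA ?inE ?hts ?orbT //=.
  by apply: contraNneq yn => <-; rewrite !inE hts !orbT.
have uA : u \in A :|: [set:: [:: y]] = false.
  apply: negbTE; rewrite A1E negb_or nA ?inE ?eqxx ?orbT //=.
  by apply: contraNneq yn => <-; rewrite !inE eqxx !orbT.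
have [|||||P' [c' [cP' _ Px cx]]] := color_vertex degree_le3 (x := x)
  (l := [:: (y, g); (head u ts, 0); (u, b)]) (q := q) cA1 xA1 qP.
- rewrite /= !inE negb_or andbT -andbA; apply/and3P; split.
  - by apply: contraNneq yn => ->; rewrite !inE hts !orbT.
  - by apply: contraNneq yn => ->; rewrite !inE eqxx !orbT.
  - by apply: contraNneq un => <-.
- exact: uq3.
- by move=> yk; rewrite !inE => /or3P[]/eqP ->.
- by move=> yk; rewrite !in_cons orbF => /or3P[]/eqP -> /=; rewrite ?hA ?uA.
- move=> t tA xt; rewrite /= !inE -NxE xt andbT.
  by move: tA; rewrite A1E => /orP[/(subsetP AB)|/eqP ->] //; rewrite sB ?mem_head.
have [cx1 cx2] : c' x (head u ts) = 0 /\ c' x u = b.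
  by split; [apply: (cx (_, _))|apply: (cx (_, _))]; rewrite !inE eqxx ?orbT.
apply: (close_loop (x := x) (u := u) (ts := ts) cP').
- apply/setP => t; rewrite in_setU1 A1E -AE !in_setD !in_set.
  have -> : (t \in [:: y, x, u & ts]) = [|| t == y, t == x | t \in u :: ts] by [].
  rewrite 2!negb_or; case: (eqVneq t x) => [->|tx].
    by rewrite xn sB // !inE eqxx orbT.
  case: (eqVneq t y) => [->|ty]; last by rewrite orbF.
  by move: yn; rewrite in_cons negb_or => /andP[_ ->]; rewrite sB ?mem_head ?orbT.
- by rewrite setU11.
- by [].
- by [].
- by case/and3P: uq => _ _ h.
- by move=> t ti; apply: sB; rewrite in_cons [t \in x :: _]in_cons ti !orbT.
- by [].
- by apply: contraNneq xn => <-; rewrite inE lts orbT.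
- by [].
- by rewrite Px.
- by [].
- by rewrite cx2; move: uq3; rewrite /= !inE andbT => /andP[_]; rewrite eq_sym.
Qed.

End Reductions.

(** * The four-vertex path and the spider, when their vertices are distinct *)

Section Configurations.

Variable G : sgraph.
Hypothesis degree_le3 : forall x : G, degree x <= 3.
Implicit Types (A B : {set G}) (x y z e t u : G) (P : G -> seq nat) (c : G -> G -> nat).

Lemma path_colorable B e1 e2 v w x y :
  uniq [:: y; v; w; x] -> {subset [:: y; v; w; x] <= B} ->
  e1 \in B :\: [set:: [:: y; v; w; x]] -> e2 \in B :\: [set:: [:: y; v; w; x]] ->
  is_leg B e1 [:: v; w; x] y -> nbrs B y = [set x; e2] ->
  colorable (B :\: [set:: [:: y; v; w; x]]) -> colorable B.
Proof.
move=> uq sB e1A e2A leg Ny [P [c cA]].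
have AB : B :\: [set:: [:: y; v; w; x]] \subset B by apply: subsetDl.
have NyE t : (t \in B) && adj y t = (t == x) || (t == e2).
  by rewrite -in_nbrs Ny !inE.
have e2y : adj e2 y by rewrite adj_sym; have := NyE e2; rewrite eqxx orbT => /andP[].
have e1v : adj e1 v.
  case/and3P: leg => _ /eqP/setP/(_ e1) + _.
  by rewrite !inE eqxx adj_sym => /andP[].
have [P1 k1] := coloringP cA e1A e1v; have [P2 k2] := coloringP cA e2A e2y.
have [q [g [qP gq /andP[q0 g0] can0]]] := path_state P2 k2.
have can3 := can3 P1 k1 qP (andP gq).1 q0 g0.
apply: (close_path (q := q) degree_le3 cA erefl e1A e2A leg) can3 can0 => //=.
apply: contraTneq e2A => <-; rewrite in_setD in_set.
by rewrite !inE eqxx !orbT.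
Qed.

(** All states at the outer ends are known beforehand, so the centre is planned first and coloured
    last. The ends [o1], [o2], [o3] may coincide; [agree] keeps their states valid while the legs
    are coloured in turn. *)
Lemma spider_colorable B x y1 z1 w1 o1 y2 z2 o2 y3 o3 :
  let R := [:: x; w1; z1; y1; z2; y2; y3] in
  uniq R -> {subset R <= B} -> {in [:: o1; o2; o3], forall o, o \notin R} ->
  is_leg B o1 [:: w1; z1; y1] x -> is_leg B o2 [:: z2; y2] x ->
  is_leg B o3 [:: y3] x -> nbrs B x = [set y1; y2; y3] ->
  colorable (B :\: [set:: R]) -> colorable B.
Proof.
move=> R uq sB oR leg1 leg2 leg3 Nx [P [c cR]].
have [A AE] : exists A, A = B :\: [set:: R] by eexists.
have cA : coloring A P c by rewrite AE.
have AB : A \subset B by rewrite AE subsetDl.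
have oA o1' t0 s : o1' \in [:: o1; o2; o3] -> is_leg B o1' (t0 :: s) x ->
    [/\ o1' \in A, P o1' \in palettes & c o1' t0 \in P o1'].
  move=> oi /= /and3P[_ /eqP Nt _].
  have /andP[oB to1] : (o1' \in B) && adj t0 o1' by rewrite -in_nbrs Nt !inE eqxx.
  have o1A : o1' \in A by rewrite AE in_setD in_set (negPf (oR _ oi)) oB.
  by split=> //; have [] := coloringP cA o1A (_ : adj o1' t0) => //; rewrite adj_sym.
have [o1A P1 k1] := oA _ _ _ (mem_head _ _) leg1.
have [|o2A P2 k2] := oA _ _ _ _ leg2; first by rewrite !inE eqxx orbT.
have [|o3A P3 k3] := oA _ _ _ _ leg3; first by rewrite !inE eqxx !orbT.
have [q [g [h [k [qP /and3P[gq hq kq] u3 /andP[q0 g0] /andP[can2 can1]]]]]] :=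
  spider_state P2 k2 P3 k3.
have can3 := can3 P1 k1 qP gq q0 g0.
have nA t : t \in R -> t \notin A by move=> tR; rewrite AE in_setD in_set tR.
have RB t : t \in R -> t \in B by apply: sB.
have [xR w1R z1R y1R] : [/\ x \in R, w1 \in R, z1 \in R & y1 \in R].
  by rewrite !inE !eqxx !orbT.
have [z2R y2R y3R] : [/\ z2 \in R, y2 \in R & y3 \in R].
  by rewrite !inE !eqxx !orbT.
(* The 21 inequalities between the seven vertices go to the context. *)
move: uq; rewrite /= !inE !negb_or -!andbA.
do 20![case/andP=> ?]; case/andP => ? _.
have [|||Pa [ca [cAa ag1 cp1 ce1]]] :=
    leg_extend degree_le3 cA AB o1A leg1 _ _ _ can3.
- by rewrite /= !inE !negb_or -!andbA; do ?[apply/andP; split].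
- by move=> t'; rewrite !inE => /or3P[]/eqP ->; apply: RB.
- by move=> t; rewrite !inE => /or4P[]/eqP ->; apply: nA.
set A1 := A :|: _ in cAa.
have A1E t : (t \in A1) = [|| t \in A, t == w1, t == z1 | t == y1] by rewrite !inE.
clearbody A1.
have A1B : A1 \subset B.
  apply/subsetP => t; rewrite A1E => /or4P[/(subsetP AB)|/eqP->|/eqP->|/eqP->] //;
  exact: RB.
have A1n : forall r, r \in R -> [&& r != w1, r != z1 & r != y1] -> r \notin A1.
  by move=> r rR; rewrite A1E !negb_or nA.
have [Po2 co2] := ag1 o2 o2A; have [Po3 co3] := ag1 o3 o3A.
have o2A1 : o2 \in A1 by rewrite A1E o2A.
rewrite -Po2 -co2 in can2.
have [|||Pb [cb [cAb ag2 cp2 ce2]]] :=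
    leg_extend degree_le3 cAa A1B o2A1 leg2 _ _ _ can2.
- by rewrite /= !inE !negb_or -!andbA; do ?[apply/andP; split].
- by move=> t; rewrite !inE => /orP[]/eqP ->; apply: RB.
- move=> t; rewrite !inE => /or3P[]/eqP ->; apply: A1n => //;
  do ?[apply/andP; split] => //; by rewrite eq_sym.
set A2 := A1 :|: _ in cAb.
have A2E t : (t \in A2) = [|| t \in A1, t == z2 | t == y2] by rewrite in_setU !inE.
clearbody A2.
have A2B : A2 \subset B.
  apply/subsetP => t; rewrite A2E => /or3P[/(subsetP A1B)|/eqP->|/eqP->] //;
  exact: RB.
have A2n : forall r, r \in R -> [&& r != w1, r != z1 & r != y1] ->
    (r != z2) && (r != y2) -> r \notin A2.
  by move=> r rR r1; rewrite A2E !negb_or A1n.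
have o3A1 : o3 \in A1 by rewrite A1E o3A.
have [Po3' co3'] := ag2 o3 o3A1.
have o3A2 : o3 \in A2 by rewrite A2E o3A1.
rewrite -Po3 -co3 -Po3' -co3' in can1.
have [|||Pc [cc [cAc ag3 cp3 ce3]]] :=
    leg_extend degree_le3 cAb A2B o3A2 leg3 _ _ _ can1.
- by rewrite /= inE andbT.
- by move=> t; rewrite !inE => /eqP ->; apply: RB.
- move=> t; rewrite !inE => /orP[]/eqP ->; apply: A2n => //;
  do ?[apply/andP; split] => //; by rewrite eq_sym.
have y1A1 : y1 \in A1 by rewrite A1E eqxx !orbT.
have y1A2 : y1 \in A2 by rewrite A2E y1A1.
have y2A2 : y2 \in A2 by rewrite A2E eqxx !orbT.
rewrite /= in cp1 ce1 cp2 ce2 cp3 ce3.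
rewrite -(ag2 y1 y1A1).1 -(ag3 y1 y1A2).1 in cp1.
rewrite -(ag2 y1 y1A1).2 -(ag3 y1 y1A2).2 in ce1.
rewrite -(ag3 y2 y2A2).1 in cp2; rewrite -(ag3 y2 y2A2).2 in ce2.
have NxE t : (t \in B) && adj x t = [|| t == y1, t == y2 | t == y3].
  by rewrite -in_nbrs Nx !inE orbA.
have [xy1 xy2 xy3] : [/\ adj x y1, adj x y2 & adj x y3].
  by split; [have := NxE y1|have := NxE y2|have := NxE y3];
    rewrite eqxx ?orbT => /andP[].
set A3 := A2 :|: _ in cAc.
have A3E t : (t \in A3) = (t \in A2) || (t == y3) by rewrite in_setU !inE.
clearbody A3.
have xA3 : x \notin A3.
  rewrite A3E negb_or A2n ?andbT //; do ?[apply/andP; split] => //.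
have [|||||Pd [cd [cPd _ _ _]]] := color_vertex degree_le3 (x := x)
  (l := [:: (y1, g); (y2, h); (y3, k)]) (q := q) cAc xA3 qP.
- by rewrite /= !inE negb_or andbT -andbA; do ?[apply/andP; split].
- exact: u3.
- by move=> yk; rewrite !in_cons orbF => /or3P[]/eqP ->.
- by move=> yk; rewrite !in_cons orbF => /or3P[]/eqP -> _.
- move=> t; rewrite A3E /= !inE => tA3 xt; rewrite -NxE xt andbT.
  by case/orP: tA3 => [/(subsetP A2B)|/eqP->] //; apply: RB.
exists Pd, cd; suff <- : x |: A3 = B by [].
apply/setP => t; rewrite in_setU1 A3E A2E A1E AE in_setD in_set /R.
case: (boolP (t \in R)) => [tR|]; rewrite /R.
  rewrite RB //=; move: tR; rewrite !inE.
  by do 6![case/orP => [->|]; rewrite ?orbT //]; move=> ->; rewrite ?orbT.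
rewrite /= !inE !negb_or => /and5P[/negPf-> /negPf-> /negPf-> /negPf-> /and3P[]].
by move=> /negPf-> /negPf-> /negPf->; rewrite /= !orbF.
Qed.
End Configurations.

(** * Finding the configurations in a minimal set, including degenerate ones *)

Section Discharging.

Variable G : sgraph.
Hypothesis degree_le3 : forall x : G, degree x <= 3.
Variable B : {set G}.
Hypothesis min_degree : forall x, x \in B -> 1 < #|nbrs B x|.
Hypothesis proper_colorable : forall A : {set G}, A \proper B -> colorable A.
Implicit Types (x y z t u v w : G).

Definition deg2 x : bool := (x \in B) && (#|nbrs B x| == 2).
Definition deg3 x : bool := (x \in B) && (#|nbrs B x| == 3).

Lemma degP x : x \in B -> deg2 x || deg3 x.
Proof.
move=> xB; rewrite /deg2 /deg3 xB /=.
have: #|nbrs B x| <= 3.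
  apply: leq_trans (degree_le3 x); apply: subset_leq_card.
  by apply/subsetP => y; rewrite !inE => /andP[].
by move: (min_degree xB); case: #|_| => [|[|[|[|]]]].
Qed.

Lemma nbrs_sym x y : x \in B -> y \in nbrs B x -> x \in nbrs B y.
Proof. by move=> xB; rewrite !inE xB adj_sym => /andP[]. Qed.

Lemma nbrs_irrefl x : x \notin nbrs B x.
Proof. by rewrite inE adj_irrefl andbF. Qed.

Lemma nbrs_sub x y : y \in nbrs B x -> y \in B.
Proof. by rewrite inE => /andP[]. Qed.

Definition other y x : G := odflt x [pick w in nbrs B y :\ x].

Lemma otherP y x : deg2 y -> x \in nbrs B y ->
  nbrs B y = [set x; other y x] /\ x != other y x.
Proof.
case/andP=> yB /cards2P[a [b [ab Ny]]].
rewrite /other Ny; case: pickP => [w|n0] /=.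
  rewrite !inE => /andP[wx] /orP[]/eqP wE /orP[]/eqP xE;
    move: wx; rewrite wE xE ?eqxx // eq_sym => wx; split=> //; exact: setUC.
rewrite !inE => /orP[]/eqP xE; subst x.
  by have := n0 b; rewrite !inE eqxx orbT eq_sym ab.
by have := n0 a; rewrite !inE eqxx ab.
Qed.

Lemma other_eq y x w : deg2 y -> x \in nbrs B y -> w \in nbrs B y -> x != w ->
  other y x = w /\ nbrs B y = [set x; w].
Proof.
move=> y2 xy; have [Ny xo] := otherP y2 xy.
rewrite Ny !inE => /orP[/eqP ->|/eqP ->] //.
by rewrite eqxx.
Qed.

Lemma setD_colorable (s : seq G) x :
  x \in s -> {subset s <= B} -> colorable (B :\: [set:: s]).
Proof.
move=> xs sB; apply: proper_colorable; apply/properP; split.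
  exact: subsetDl.
by exists x; rewrite ?sB // in_setD in_set xs.
Qed.

Lemma path4_colorable v w x y : deg2 v -> deg2 w -> deg2 x -> deg2 y ->
  w \in nbrs B v -> x \in nbrs B w -> y \in nbrs B x -> v != x -> w != y ->
  colorable B.
Proof.
move=> v2 w2 x2 y2 vw wx xy vx wy.
have [[vB wB] [xB yB]] : (v \in B /\ w \in B) /\ (x \in B /\ y \in B).
  by move: v2 w2 x2 y2 => /andP[-> _] /andP[-> _] /andP[-> _] /andP[-> _].
have wv := nbrs_sym vB vw; have xw := nbrs_sym wB wx; have yx := nbrs_sym xB xy.
have [_ Nw] := other_eq w2 wv wx vx.
have [_ Nx] := other_eq x2 xw xy wy.
have [Nv we1] := otherP v2 vw; set e1 := other v w in Nv we1.
have [Ny xe2] := otherP y2 yx; set e2 := other y x in Ny xe2.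
have ne a b : b \in nbrs B a -> a != b.
  by move=> ab; apply: contraTneq ab => ->; apply: nbrs_irrefl.
have [[vw' wx'] xy'] := (ne _ _ vw, ne _ _ wx, ne _ _ xy).
(* The walk may close up to a triangle here, and to a four-cycle in the next case; both are
   components. *)
case: (eqVneq y v) => [yv|yv].
  subst y.
  have [_ Nv'] := other_eq v2 vw yx wx'.
  have sB : {subset [:: v; x; w] <= B} by move=> t; rewrite !inE => /or3P[]/eqP->.
  apply: (cycle_colorable degree_le3 (x := v) (ts := [:: w]) (u := x)) => //=.
  - by rewrite !inE negb_or vx vw' /= andbT eq_sym wx'.
  - by rewrite vx Nw eqxx.
  - exact: (setD_colorable (mem_head _ _) sB).
have [e1v e2y] : e1 \in nbrs B v /\ e2 \in nbrs B y.
  by rewrite Nv Ny !inE !eqxx !orbT.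
have ve1 := nbrs_sym vB e1v; have ye2 := nbrs_sym yB e2y.
case: (eqVneq e1 y) => [e1y|e1y].
  have vy : v \in nbrs B y by rewrite -e1y.
  have xv : x != v by rewrite eq_sym.
  have [_ Ny'] := other_eq y2 yx vy xv.
  have sB : {subset [:: v; y; w; x] <= B} by move=> t; rewrite !inE => /or4P[]/eqP->.
  apply: (cycle_colorable degree_le3 (x := v) (ts := [:: w; x]) (u := y)) => //=.
  - by rewrite !inE !negb_or vx vw' eq_sym yv (eq_sym y w) (eq_sym y x) wy xy' wx'.
  - by rewrite vx Nw Nx wy !eqxx.
  - by rewrite Nv e1y.
  - exact: (setD_colorable (mem_head _ _) sB).
have sB : {subset [:: y; v; w; x] <= B} by move=> t; rewrite !inE => /or4P[]/eqP->.
apply: (path_colorable degree_le3 (e1 := e1) (e2 := e2)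
  (v := v) (w := w) (x := x) (y := y)) => //=.
- by rewrite !inE !negb_or yv vx vw' (eq_sym y w) (eq_sym y x) wy xy' wx'.
- rewrite in_setD in_set (nbrs_sub e1v) andbT !inE !negb_or e1y eq_sym ne //=.
  rewrite (eq_sym e1 w) we1 /=; apply: contraTneq ve1 => ->.
  by rewrite Nx !inE negb_or vw' eq_sym yv.
- rewrite in_setD in_set (nbrs_sub e2y) andbT !inE !negb_or (eq_sym e2 y) ne //=.
  rewrite (eq_sym e2 x) xe2 andbT; apply/andP; split.
    by apply: contraTneq ye2 => ->; rewrite Nv !inE negb_or (eq_sym y w) wy eq_sym.
  by apply: contraTneq ye2 => ->; rewrite Nw !inE negb_or yv eq_sym.
- by rewrite (eq_sym e1 w) we1 vx wy Nw Nx Nv setUC !eqxx.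
- exact: (setD_colorable (mem_head _ _) sB).
Qed.

Lemma nbrs_neq x y : y \in nbrs B x -> x != y.
Proof. by apply: contraTneq => ->; apply: nbrs_irrefl. Qed.

Lemma deg2_in x : deg2 x -> x \in B.
Proof. by case/andP. Qed.

Lemma triangle_colorable x y t u : nbrs B x = [set y; t; u] ->
  y != t -> y != u -> deg2 y -> deg2 t -> deg2 u -> u \in nbrs B t ->
  x \in B -> colorable B.
Proof.
move=> Nx yt yu y2 t2 u2 ut xB.
have [xy xt xu] : [/\ y \in nbrs B x, t \in nbrs B x & u \in nbrs B x].
  by rewrite Nx !inE !eqxx !orbT.
have yx := nbrs_sym xB xy; have tx := nbrs_sym xB xt; have ux := nbrs_sym xB xu.
have tu := nbrs_sym (deg2_in t2) ut.
have [xy' xt' xu'] := And3 (nbrs_neq xy) (nbrs_neq xt) (nbrs_neq xu).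
have tx' : t != x by rewrite eq_sym.
have [_ Nt] := other_eq t2 tx ut xu'.
have [_ Nu] := other_eq u2 tu ux tx'.
have [Ny xz] := otherP y2 yx; set z := other y x in Ny xz.
have zy : z \in nbrs B y by rewrite Ny !inE eqxx orbT.
have yz := nbrs_sym (deg2_in y2) zy.
have sB : {subset [:: y; x; u; t] <= B}.
  by move=> w; rewrite !inE => /or4P[]/eqP-> //; apply: deg2_in.
apply: (lollipop_colorable degree_le3 (x := x) (y := y) (z := z)
  (ts := [:: t]) (u := u)) => //=.
- by rewrite !inE !negb_or (eq_sym y x) xy' yu yt xu' xt' eq_sym (nbrs_neq ut).
- by rewrite xu' Nt eqxx.
- by rewrite Ny setUC.
- by rewrite eq_sym.
- rewrite !inE !negb_or (eq_sym z y) (nbrs_neq zy) (eq_sym z x) xz /=.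
  apply/andP; split; apply: contraTneq yz => ->.
    by rewrite Nu !inE negb_or yt eq_sym.
  by rewrite Nt !inE negb_or yu eq_sym xy'.
- exact: (setD_colorable (mem_head _ _) sB).
Qed.

Lemma square_colorable x y t s u : nbrs B x = [set y; t; u] ->
  y != t -> y != u -> t != u -> deg2 y -> deg2 t -> deg2 s -> deg2 u ->
  s \in nbrs B t -> s \in nbrs B u -> s != x -> x \in B -> colorable B.
Proof.
move=> Nx yt yu tu y2 t2 s2 u2 st su sx xB.
have [xy xt xu] : [/\ y \in nbrs B x, t \in nbrs B x & u \in nbrs B x].
  by rewrite Nx !inE !eqxx !orbT.
have yx := nbrs_sym xB xy; have tx := nbrs_sym xB xt; have ux := nbrs_sym xB xu.
have ts := nbrs_sym (deg2_in t2) st; have us := nbrs_sym (deg2_in u2) su.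
have [xy' xt' xu'] := And3 (nbrs_neq xy) (nbrs_neq xt) (nbrs_neq xu).
have xs : x != s by rewrite eq_sym.
have [_ Nt] := other_eq t2 tx st xs.
have [_ Ns] := other_eq s2 ts us tu.
have [_ Nu] := other_eq u2 su ux sx.
have [Ny xz] := otherP y2 yx; set z := other y x in Ny xz.
have zy : z \in nbrs B y by rewrite Ny !inE eqxx orbT.
have yz := nbrs_sym (deg2_in y2) zy.
have ys : y != s.
  by apply: contraTneq yx => ->; rewrite Ns !inE negb_or xt' xu'.
have sB : {subset [:: y; x; u; t; s] <= B}.
  by move=> w; rewrite !inE => /or4P[|||/orP[]]/eqP-> //; apply: deg2_in.
apply: (lollipop_colorable degree_le3 (x := x) (y := y) (z := z)
  (ts := [:: t; s]) (u := u)) => //=.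
- rewrite !inE !negb_or (eq_sym y x) xy' yu yt ys xu' xt' xs (eq_sym u t) tu.
  by rewrite (nbrs_neq su) (nbrs_neq st).
- by rewrite xs tu Nt Ns !eqxx.
- by rewrite Ny setUC.
- by rewrite eq_sym.
- rewrite !inE !negb_or (eq_sym z y) (nbrs_neq zy) (eq_sym z x) xz /=.
  apply/and3P; split; apply: contraTneq yz => ->.
  - by rewrite Nu !inE negb_or ys eq_sym.
  - by rewrite Nt !inE negb_or ys eq_sym xy'.
  - by rewrite Ns !inE negb_or yt.
- exact: (setD_colorable (mem_head _ _) sB).
Qed.

(* legk x y: the walk leaving x through y starts with at least k vertices of  *)
(* degree two.                                                                *)
Definition leg1 x y := deg2 y.
Definition leg2 x y := leg1 x y && deg2 (other y x).
Definition leg3 x y := leg2 x y && deg2 (other (other y x) y).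

(** Legs that run into each other close a cycle through [x]. If its length is three or four, the
    third leg makes it a lollipop; if five, it contains four consecutive vertices of degree two.
    Otherwise the spider is genuine. *)
Lemma legs_colorable x y1 y2 y3 : x \in B -> nbrs B x = [set y1; y2; y3] ->
  y1 != y2 -> y1 != y3 -> y2 != y3 -> ~~ deg2 x ->
  leg3 x y1 -> leg2 x y2 -> leg1 x y3 -> colorable B.
Proof.
move=> xB Nx y12 y13 y23 x3 /andP[/andP[d1 dz1] dw1] /andP[d2 dz2] d3.
rewrite /leg1 in d1 d2 d3.
have [xy1 xy2 xy3] : [/\ y1 \in nbrs B x, y2 \in nbrs B x & y3 \in nbrs B x].
  by rewrite Nx !inE !eqxx !orbT.
have y1x := nbrs_sym xB xy1; have y2x := nbrs_sym xB xy2.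
have y3x := nbrs_sym xB xy3.
have [N1 xz1] := otherP d1 y1x; set z1 := other y1 x in N1 xz1 dz1 dw1.
have [N2 xz2] := otherP d2 y2x; set z2 := other y2 x in N2 xz2 dz2.
have [N3 xo3] := otherP d3 y3x; set o3 := other y3 x in N3 xo3.
have z1y1 : z1 \in nbrs B y1 by rewrite N1 !inE eqxx orbT.
have z2y2 : z2 \in nbrs B y2 by rewrite N2 !inE eqxx orbT.
have o3y3 : o3 \in nbrs B y3 by rewrite N3 !inE eqxx orbT.
have [Mz1 yw1] := otherP dz1 (nbrs_sym (deg2_in d1) z1y1).
set w1 := other z1 y1 in Mz1 yw1 dw1.
have [Mz2 yo2] := otherP dz2 (nbrs_sym (deg2_in d2) z2y2).
set o2 := other z2 y2 in Mz2 yo2.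
have w1z1 : w1 \in nbrs B z1 by rewrite Mz1 !inE eqxx orbT.
have o2z2 : o2 \in nbrs B z2 by rewrite Mz2 !inE eqxx orbT.
have [Mw1 zo1] := otherP dw1 (nbrs_sym (deg2_in dz1) w1z1).
set o1 := other w1 z1 in Mw1 zo1.
have o1w1 : o1 \in nbrs B w1 by rewrite Mw1 !inE eqxx orbT.
have neq_x a : deg2 a -> x != a by move=> da; apply: contraNneq x3 => ->.
have [N312 N213] : nbrs B x = [set y3; y1; y2] /\ nbrs B x = [set y2; y1; y3].
  by rewrite Nx; split; apply/setP => t; rewrite !inE;
    case: (t == y1); case: (t == y2); case: (t == y3).
have [y21 y31 y32] : [/\ y2 != y1, y3 != y1 & y3 != y2] by rewrite !(eq_sym _ y1) (eq_sym y3).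
have zx : z1 != x by rewrite eq_sym.
have zx2 : z2 != x by rewrite eq_sym.
clearbody o1 o2 o3 w1 z1 z2.
case: (eqVneq z1 y2) => [e|z1y2].
  by subst z1; exact: (triangle_colorable N312 y31 y32).
case: (eqVneq z1 y3) => [e|z1y3].
  by subst z1; exact: (triangle_colorable N213 y21 y23).
case: (eqVneq z2 y1) => [e|z2y1].
  have N321 : nbrs B x = [set y3; y2; y1] by rewrite N312 setUAC.
  by subst z2; exact: (triangle_colorable N321 y32 y31).
case: (eqVneq z2 y3) => [e|z2y3].
  by subst z2; exact: (triangle_colorable Nx y12 y13).
case: (eqVneq z1 z2) => [e|z12].
  by subst z2; exact: (square_colorable N312 y31 y32 y12 d3 d1 dz1 d2).
have z1w1 := nbrs_sym (deg2_in dz1) w1z1.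
have z2o2 := nbrs_sym (deg2_in dz2) o2z2.
case: (eqVneq w1 y2) => [e|w1y2].
  by subst w1; exact: (square_colorable N312 y31 y32 y12 d3 d1 dz1 d2).
case: (eqVneq w1 y3) => [e|w1y3].
  by subst w1; exact: (square_colorable N213 y21 y23 y13 d2 d1 dz1 d3).
have y1z1 := nbrs_sym (deg2_in d1) z1y1; have y2z2 := nbrs_sym (deg2_in d2) z2y2.
case: (eqVneq w1 z2) => [e|w1z2].
  by subst w1; apply: (path4_colorable d1 dz1 dz2 d2).
(* If the long leg continues, it contains a path of four. Otherwise [o1] differs from every leg
   vertex because its degree is not two. *)
case: (boolP (deg2 o1)) => [do1|do1].
  by apply: (path4_colorable d1 dz1 dw1 do1).
case: (eqVneq o2 y3) => [e|o2y3].
  by subst o2; exact: (square_colorable Nx y12 y13 y23 d1 d2 dz2 d3).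
have neq_o1 a : deg2 a -> o1 != a by move=> da; apply: contraNneq do1 => ->.
have xnot a : deg2 a -> a != y1 -> a != y2 -> a != y3 -> x \notin nbrs B a.
  move=> da a1 a2 a3; apply/negP => /(nbrs_sym (deg2_in da)).
  by rewrite Nx !inE (negPf a1) (negPf a2) (negPf a3).
have o1x : o1 != x by apply: contraTneq o1w1 => ->; apply: xnot; rewrite // eq_sym.
have y3o3 := nbrs_sym (deg2_in d3) o3y3.
have nmem a b t : t != a -> t != b -> t \notin [set a; b].
  by move=> ta tb; rewrite !inE negb_or ta.
have [o2x o2y1 o2z1 o2w1] : [/\ o2 != x, o2 != y1, o2 != z1 & o2 != w1].
  split; [apply: contraTneq o2z2 => ->|apply: contraTneq z2o2 => ->
    |apply: contraTneq z2o2 => ->|apply: contraTneq z2o2 => ->].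
  - by apply: xnot; rewrite // eq_sym (nbrs_neq z2y2).
  - by rewrite N1 nmem // eq_sym.
  - by rewrite Mz1 nmem // eq_sym.
  - by rewrite Mw1 nmem 1?eq_sym // neq_o1.
have [o3y1 o3y2] : o3 != y1 /\ o3 != y2.
  split; apply: contraTneq y3o3 => ->.
  - by rewrite N1 nmem // eq_sym // neq_x.
  - by rewrite N2 nmem // eq_sym // neq_x.
have [o3z1 o3w1 o3z2] : [/\ o3 != z1, o3 != w1 & o3 != z2].
  split; apply: contraTneq y3o3 => ->.
  - by rewrite Mz1 nmem // eq_sym.
  - by rewrite Mw1 nmem // eq_sym // neq_o1.
  - by rewrite Mz2 nmem // eq_sym.
have [xy1' xy2' xy3'] := And3 (nbrs_neq xy1) (nbrs_neq xy2) (nbrs_neq xy3).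
have [yz1 yz2] := conj (nbrs_neq z1y1) (nbrs_neq z2y2).
have [zw1 zo2] := conj (nbrs_neq w1z1) (nbrs_neq o2z2).
have yo3 := nbrs_neq o3y3.
have sB : {subset [:: x; w1; z1; y1; z2; y2; y3] <= B}.
  move=> t; rewrite !inE; do 6?[case/orP => [/eqP->|]];
  by [|apply: deg2_in|move=> /eqP->; apply: deg2_in].
apply: (spider_colorable degree_le3 (x := x) (y1 := y1) (z1 := z1) (w1 := w1)
  (o1 := o1) (y2 := y2) (z2 := z2) (o2 := o2) (y3 := y3) (o3 := o3)) => //.
- rewrite /= !inE !negb_or andbT -!andbA; do 20?[apply/andP; split] => //;
  by [apply: neq_x|rewrite eq_sym].
- move=> o; rewrite !in_cons !orbF => /or3P[]/eqP->;
  rewrite !negb_or -?andbA; do 6?[apply/andP; split] => //;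
  by [apply: neq_o1|rewrite eq_sym].
- by rewrite /= eq_sym zo1 (eq_sym w1) yw1 zx Mw1 Mz1 N1 [[set o1; _]]setUC [[set w1; _]]setUC
    [[set z1; x]]setUC !eqxx.
- by rewrite /= eq_sym yo2 zx2 Mz2 N2 [[set o2; _]]setUC [[set z2; x]]setUC !eqxx.
- by rewrite /= eq_sym xo3 N3 setUC eqxx.
- exact: (setD_colorable (mem_head _ _) sB).
Qed.

End Discharging.

(** * Double counting of darts *)

Lemma card_rel (T : finType) (p : rel T) :
  #|[set d : T * T | p d.1 d.2]| = \sum_x #|[set y | p x y]|.
Proof.
rewrite -sum1_card (eq_bigl (fun d => true && p d.1 d.2)); last by move=> d; rewrite inE.
rewrite -(pair_big_dep xpredT p (fun _ _ => 1)) /=; apply: eq_bigr => x _.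
by rewrite -sum1_card; apply: eq_bigl => y; rewrite inE.
Qed.

Lemma card_relV (T : finType) (p : rel T) :
  #|[set d : T * T | p d.1 d.2]| = \sum_y #|[set x | p x y]|.
Proof.
rewrite card_rel (eq_bigr (fun x => \sum_(y | p x y) 1)); last first.
  by move=> x _; rewrite -sum1_card; apply: eq_bigl => y; rewrite inE.
rewrite (exchange_big_dep xpredT) //=; apply: eq_bigr => y _.
by rewrite -sum1_card; apply: eq_bigl => x; rewrite inE.
Qed.

Section Counting.

Variable G : sgraph.
Hypothesis degree_le3 : forall x : G, degree x <= 3.
Variable B : {set G}.
Hypothesis min_degree : forall x, x \in B -> 1 < #|nbrs B x|.
Hypothesis proper_colorable : forall A : {set G}, A \proper B -> colorable A.
Implicit Types (x y z t u v w : G).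

Local Notation deg2 := (deg2 B).
Local Notation deg3 := (deg3 B).

Definition has_path4 : bool := [exists v, exists w, exists x, exists y,
  [&& deg2 v, deg2 w, deg2 x, deg2 y & [&& w \in nbrs B v, x \in nbrs B w,
   y \in nbrs B x, v != x & w != y]]].

Definition has_spider : bool := [exists x, exists y1, exists y2, exists y3,
  [&& deg3 x, nbrs B x == [set y1; y2; y3], [&& y1 != y2, y1 != y3 & y2 != y3],
   leg3 B x y1, leg2 B x y2 & leg1 B x y3]].

Lemma deg3_not2 x : deg3 x -> ~~ deg2 x.
Proof. by rewrite /deg2 /deg3 => /andP[-> /eqP ->]. Qed.

Lemma has_path4_colorable : has_path4 -> colorable B.
Proof.
case/existsP=> v /existsP[w /existsP[x /existsP[y]]].
case/and5P => v2 w2 x2 y2 /and5P[vw wx xy vx wy].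
exact: (path4_colorable degree_le3 proper_colorable v2 w2 x2 y2).
Qed.

Lemma has_spider_colorable : has_spider -> colorable B.
Proof.
case/existsP=> x /existsP[y1 /existsP[y2 /existsP[y3]]].
case/and5P => x3 /eqP Nx /and3P[y12 y13 y23] l3 /andP[l2 l1].
apply: (legs_colorable degree_le3 proper_colorable _ Nx y12 y13 y23) => //.
  by case/andP: x3.
exact: deg3_not2.
Qed.

Definition deg2_darts := [set d : G * G | deg2 d.2 && (d.1 \in nbrs B d.2)].
Definition leg_darts (l : G -> G -> bool) :=
  [set d : G * G | [&& deg3 d.1, d.2 \in nbrs B d.1 & l d.1 d.2]].
Definition advance (d : G * G) := (d.2, other B d.2 d.1).

(** Going back from a dart, one meets a vertex of degree three after at most three vertices of
    degree two. The dart is thus reached from a leg by zero, one or two advances. *)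
Lemma deg2_darts_cover : ~~ has_path4 ->
  deg2_darts \subset leg_darts (leg1 B) :|: (advance @: leg_darts (leg2 B)
    :|: (advance \o advance) @: leg_darts (leg3 B)).
Proof.
move=> np; apply/subsetP => -[x y]; rewrite in_set /= => /andP[y2 yx].
have yB := deg2_in y2; have xy := nbrs_sym yB yx; have xB := nbrs_sub yx.
rewrite !in_setU [_ \in leg_darts (leg1 B)]in_set /= xy /leg1 y2 !andbT.
case: (boolP (deg3 x)) => //= x3.
have x2 : deg2 x by have := degP degree_le3 min_degree xB; rewrite (negPf x3) orbF.
have [Nx yw] := otherP x2 xy; set w := other B x y in Nx yw.
have wx : w \in nbrs B x by rewrite Nx !inE eqxx orbT.
have wB := nbrs_sub wx; have xw := nbrs_sym xB wx.
have wy : w != y by rewrite eq_sym.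
have [oxw _] := other_eq x2 wx xy wy.
case: (boolP (deg3 w)) => w3.
  apply/orP; left; apply/imsetP; exists (w, x); last by rewrite /advance /= oxw.
  by rewrite in_set /= w3 xw /leg2 /leg1 x2 oxw y2.
have w2 : deg2 w by have := degP degree_le3 min_degree wB; rewrite (negPf w3) orbF.
have [Nw xv] := otherP w2 xw; set v := other B w x in Nw xv.
have vw : v \in nbrs B w by rewrite Nw !inE eqxx orbT.
have vB := nbrs_sub vw; have wv := nbrs_sym wB vw.
have vx : v != x by rewrite eq_sym.
have [owv _] := other_eq w2 vw xw vx.
(* Otherwise [v], [w], [x], [y] would be a forbidden path. *)
have v3 : deg3 v.
  have := degP degree_le3 min_degree vB; case/orP => // v2.
  case/negP: np; apply/existsP; exists v; apply/existsP; exists w.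
  apply/existsP; exists x; apply/existsP; exists y.
  by rewrite v2 w2 x2 y2 wv xw xy vx wy.
apply/orP; right; apply/imsetP; exists (v, w); last first.
  by rewrite /advance /= owv oxw.
by rewrite in_set /= v3 wv /leg3 /leg2 /leg1 w2 owv x2 oxw y2.
Qed.

(** The left side adds up the three leg lengths, each truncated at 3. Lengths that do not dominate
    (3, 2, 1) in any order sum to at most six, as in 3 + 3 + 0 and 2 + 2 + 2. *)
Lemma leg_count x : ~~ has_spider -> deg3 x ->
  #|[set y in nbrs B x | leg1 B x y]| + #|[set y in nbrs B x | leg2 B x y]|
    + #|[set y in nbrs B x | leg3 B x y]| <= 6.
Proof.
move=> ns x3; have /andP[_ /eqP N3] := x3.
have [y1 [y2 [y3 [[y12 y13 y23] Nx]]]] : exists y1 y2 y3,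
    [/\ y1 != y2, y1 != y3 & y2 != y3] /\ nbrs B x = [set y1; y2; y3].
  have /card_gt0P[y1 y1N] : 0 < #|nbrs B x| by rewrite N3.
  have /eqP/cards2P[y2 [y3 [y23 NE]]] : #|nbrs B x :\ y1| = 2.
    by have := cardsD1 y1 (nbrs B x); rewrite y1N N3 => -[].
  exists y1, y2, y3; split; last by rewrite -(setD1K y1N) NE setUA.
  split=> //; rewrite eq_sym.
    by have := setD11 y1 (nbrs B x); rewrite NE !inE eq_sym => /norP[].
  by have := setD11 y1 (nbrs B x); rewrite NE !inE !(eq_sym y1) => /norP[].
have cnt (l : G -> G -> bool) : #|[set y in nbrs B x | l x y]| =
    l x y1 + l x y2 + l x y3.
  rewrite -sum1_card (eq_bigl (fun y => (y \in nbrs B x) && l x y)); last first.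
    by move=> y; rewrite !inE.
  rewrite big_mkcondr Nx -setUA big_setU1 /=; last by rewrite !inE negb_or y12.
  rewrite big_setU1 ?inE //= big_set1 addnA.
  by case: (l x y1); case: (l x y2); case: (l x y3).
have Nperm a b c : [set a; b; c] = [set y1; y2; y3] ->
    [&& a != b, a != c & b != c] -> ~~ [&& leg3 B x a, leg2 B x b & leg1 B x c].
  move=> Na abc; apply: contra ns => /and3P[la lb lc].
  apply/existsP; exists x; apply/existsP; exists a; apply/existsP; exists b.
  by apply/existsP; exists c; rewrite x3 Nx Na eqxx abc la lb lc.
have perm a b c : [set a; b; c] = [set b; a; c] :> {set G} by rewrite (setUC [set a]).
have P1 := Nperm y1 y2 y3 erefl; have P2 := Nperm y1 y3 y2 (setUAC _ _ _).
have P3 := Nperm y2 y1 y3 (perm _ _ _).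
have P4 := Nperm y2 y3 y1 (etrans (setUAC _ _ _) (perm _ _ _)).
have P5 := Nperm y3 y1 y2 (etrans (perm _ _ _) (setUAC _ _ _)).
have P6 := Nperm y3 y2 y1 (etrans (etrans (perm _ _ _) (setUAC _ _ _)) (perm _ _ _)).
move: P1 P2 P3 P4 P5 P6; rewrite !(eq_sym y3) (eq_sym y2 y1) y12 y13 y23.
move=> /(_ isT) + /(_ isT) + /(_ isT) + /(_ isT) + /(_ isT) + /(_ isT).
rewrite !cnt /leg3 /leg2.
case: (leg1 B x y1); case: (leg1 B x y2); case: (leg1 B x y3) => //=;
case: (deg2 (other B y1 x)); case: (deg2 (other B y2 x));
case: (deg2 (other B y3 x)) => //=;
case: (deg2 (other B (other B y1 x) y1)); case: (deg2 (other B (other B y2 x) y2));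
by case: (deg2 (other B (other B y3 x) y3)).
Qed.

Lemma deg2_le_deg3 : ~~ has_path4 -> ~~ has_spider ->
  #|[set x | deg2 x]| <= 3 * #|[set x | deg3 x]|.
Proof.
move=> np ns; rewrite -(leq_pmul2l (isT : 0 < 2)) mulnA.
have -> : 2 * #|[set x | deg2 x]| = #|deg2_darts|.
  rewrite /deg2_darts (card_relV (fun x y => deg2 y && (x \in nbrs B y))).
  rewrite (bigID deg2) /= [X in _ + X]big1 => [|y /negPf ny]; last first.
    by apply: eq_card0 => x; rewrite inE ny.
  rewrite addn0 (eq_bigr (fun=> 2)) => [|y y2]; last first.
    have /andP[_ /eqP <-] := y2; apply: eq_card => x; by rewrite inE y2.
  by rewrite sum_nat_const cardsE mulnC.
apply: leq_trans (subset_leq_card (deg2_darts_cover np)) _.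
have cU (X Y : {set G * G}) : #|X :|: Y| <= #|X| + #|Y|.
  by rewrite cardsU leq_subr.
apply: leq_trans (cU _ _) _.
apply: (@leq_trans (#|leg_darts (leg1 B)| + (#|leg_darts (leg2 B)| + #|leg_darts (leg3 B)|))).
  rewrite leq_add2l; apply: leq_trans (cU _ _) _.
  by apply: leq_add; apply: leq_imset_card.
have cl l : #|leg_darts l| = \sum_(x | deg3 x) #|[set y in nbrs B x | l x y]|.
  rewrite /leg_darts (card_rel (fun x y => [&& deg3 x, y \in nbrs B x & l x y])).
  rewrite (bigID deg3) /= [X in _ + X]big1 => [|x /negPf nx]; last first.
    by apply: eq_card0 => y; rewrite inE nx.
  rewrite addn0; apply: eq_bigr => x x3; apply: eq_card => y.
  by rewrite !inE x3.
rewrite !cl addnA -!big_split /= cardsE mulnC -sum_nat_const.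
by apply: leq_sum => x; apply: leg_count.
Qed.

Lemma sparse_colorable : 4 * \sum_(x in B) #|nbrs B x| < 9 * #|B| -> colorable B.
Proof.
move=> sp.
case: (boolP has_path4) => [/has_path4_colorable //|np].
case: (boolP has_spider) => [/has_spider_colorable //|ns].
have := deg2_le_deg3 np ns; set n2 := #|_|; set n3 := #|_| => n23.
suff [cB cs] : #|B| = n2 + n3 /\ \sum_(x in B) #|nbrs B x| = 2 * n2 + 3 * n3.
  (* Sparsity reads [4 * (2 * n2 + 3 * n3) < 9 * (n2 + n3)], that is [3 * n3 < n2]. *)
  by rewrite cB cs in sp; lia.
have B2 : [set x | deg2 x] = [set x in B | deg2 x].
  by apply/setP => x; rewrite !inE /deg2; case: (x \in B).
have B3 x : x \in B -> deg3 x = ~~ deg2 x.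
  move=> xB; have := degP degree_le3 min_degree xB.
  by case: (boolP (deg3 x)) => [/deg3_not2 -> //|_]; rewrite orbF => ->.
have B3' : [set x | deg3 x] = [set x in B | ~~ deg2 x].
  apply/setP => x; rewrite !inE; case: (boolP (x \in B)) => [/B3 //|nx].
  by rewrite /deg3 (negPf nx).
split.
  rewrite /n2 /n3 B2 B3' -!sum1_card (bigID deg2) /=.
  by congr (_ + _); apply: eq_bigl => x; rewrite !inE.
rewrite (bigID deg2) /=; congr (_ + _).
  rewrite /n2 B2 mulnC -sum_nat_const; apply: eq_big => x; first by rewrite !inE.
  by case/andP => _ /andP[_ /eqP].
rewrite /n3 B3' mulnC -sum_nat_const; apply: eq_big => x; first by rewrite !inE.
by case/andP => xB; rewrite -B3 // => /andP[_ /eqP].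
Qed.

End Counting.

(** * Induction on the vertex set, and sparsity from the maximum average degree *)

Lemma all_colorable (G : sgraph) : (forall x : G, degree x <= 3) ->
  (forall A : {set G}, A != set0 -> 4 * \sum_(x in A) #|nbrs A x| < 9 * #|A|) ->
  forall A : {set G}, colorable A.
Proof.
move=> d3 sp A; move: {2}#|A|.+1 (ltnSn #|A|) => n.
elim: n A => // n IH A; rewrite ltnS => An.
have pA (C : {set G}) : C \proper A -> colorable C.
  by move=> /proper_card CA; apply: IH; apply: leq_trans CA An.
case: (eqVneq A set0) => [->|A0]; first exact: set0_colorable.
case: (boolP [exists x in A, #|nbrs A x| <= 1]) => [/exists_inP[x xA Nx]|].
  by apply: (pendant_colorable d3 xA Nx); apply: pA; rewrite properD1.
move=> /exists_inPn mA; apply: (sparse_colorable d3 _ pA (sp A A0)).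
by move=> x /mA; rewrite -ltnNge.
Qed.

Lemma edgesP (G : sgraph) (f : {set G}) :
  reflect (exists x y, adj x y /\ f = [set x; y]) (f \in edges G).
Proof.
apply: (iffP imsetP) => [[[x y] /= xy ->]|[x [y [xy ->]]]].
  by exists x, y.
by exists (x, y).
Qed.

Lemma sum_nbrs_le (G : sgraph) (A : {set G}) :
  \sum_(x in A) #|nbrs A x| <= 2 * #|[set f in edges G | f \subset A]|.
Proof.
set F := [set f in _ | _].
have h x : x \in A -> #|nbrs A x| <= \sum_(f in F) (x \in f).
  move=> xA; rewrite -big_mkcondr /= sum1_card.
  rewrite -(card_in_imset (f := fun y => [set x; y])); last first.
    move=> y z; rewrite !inE => /andP[_ xy] _ /setP/(_ y).
    by rewrite !inE eqxx orbT; case: eqVneq xy => [->|_ _ /esym/eqP//]; rewrite adj_irrefl.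
  apply: subset_leq_card; apply/subsetP => _ /imsetP[y + ->].
  rewrite in_nbrs => /andP[yA xy].
  suff: ([set x; y] \in F) && (x \in [set x; y]) by [].
  rewrite !inE eqxx andbT subUset !sub1set xA yA /= andbT.
  by apply/edgesP; exists x, y.
apply: (@leq_trans (\sum_(x in A) \sum_(f in F) (x \in f))); first exact: leq_sum.
rewrite exchange_big mulnC -sum_nat_const.
apply: leq_sum => f; rewrite inE => /andP[/edgesP[x [y [xy ->]]] _].
rewrite -big_mkcondr /= sum1_card.
apply: leq_trans (subset_leq_card _) (_ : #|[set x; y]| <= 2).
  by apply/subsetP => z /andP[].
by rewrite cards2; case: eqP.
Qed.

Lemma mad_sparse (G : sgraph) : (mad G < 9 / 4 :> rat)%R ->
  forall A : {set G}, A != set0 -> 4 * \sum_(x in A) #|nbrs A x| < 9 * #|A|.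
Proof.
move=> madG A A0; set F := [set f in edges G | f \subset A].
have : ((2 * #|F|)%:R / #|A|%:R <= mad G :> rat)%R.
  apply: (@Order.TotalTheory.le_bigmax_cond _ _ _ _ (A, F)
    (fun H => is_subgraph H && (H.1 != set0))
    (fun H => ((2 * #|H.2|)%:R / #|H.1|%:R)%R)).
  rewrite /= A0 andbT; apply/andP; split.
    by apply/subsetP => f; rewrite inE => /andP[].
  by apply/forall_inP => f; rewrite inE => /andP[].
move=> /Order.POrderTheory.le_lt_trans/(_ madG).
have A0' : (0 < #|A|%:R :> rat)%R by rewrite Num.Theory.ltr0n card_gt0.
rewrite Num.Theory.ltr_pdivrMr // GRing.mulrAC Num.Theory.ltr_pdivlMr ?Num.Theory.ltr0n //.
rewrite -!GRing.natrM Num.Theory.ltr_nat => h.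
by have := sum_nbrs_le A; rewrite -/F; lia.
Qed.

(** * From palettes to distances in the line graph *)

Lemma dist_at_leastP (G : sgraph) d (x y : G) :
  (forall n, walk_of_length x y n -> d <= n) -> dist_at_least d x y.
Proof.
move=> h; rewrite /dist_at_least /dist; case: walkP => // xy.
by case: ex_minnP => m wm _; apply: h.
Qed.

Lemma coloring_packing (G : sgraph) (P : G -> seq nat) c :
  coloring [set: G] P c -> packing_edge_colorable [:: 1; 2; 2; 2; 2] G.
Proof.
move=> [c1 c2].
have cP x y : adj x y -> c x y \in P x /\ c x y < 5.
  move=> xy; have [Px _ /(_ y xy) h] := c1 x (in_setT x).
  by rewrite h (palettes_lt5 Px h).
have cI x y z : adj x y -> adj x z -> c x y = c x z -> y = z.
  by have [_ h _] := c1 x (in_setT x); apply: h.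
have cS x y : adj x y -> c x y = c y x.
  by move=> /(c2 _ _ (in_setT x) (in_setT y))[].
have cC x y k : adj x y -> k \in P x -> k \in P y -> k != 0 -> k = c x y.
  move=> /(c2 _ _ (in_setT x) (in_setT y))[_ /and3P[_ _ /allP h]] /h/implyP hk.
  by move=> /hk/orP[/eqP->|/eqP].
have endsP (f : edge G) x : x \in val f -> exists2 y, adj x y & val f = [set x; y].
  case/edgesP: (valP f) => a [b [ab ->]]; rewrite !inE => /orP[]/eqP->.
    by exists b.
  by exists a; rewrite 1?adj_sym // setUC.
pose col (f : edge G) := odflt 0
  (omap (fun p => c p.1 p.2) [pick p : G * G | adj p.1 p.2 && (val f == [set p.1; p.2])]).
have colE (f : edge G) x y : adj x y -> val f = [set x; y] -> col f = c x y.
  move=> xy fE; rewrite /col; case: pickP => [[a b]|/(_ (x, y))] /=; last first.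
    by rewrite xy fE eqxx.
  rewrite fE => /andP[ab /eqP /setP E].
  have := E x; have := E y; rewrite !inE !eqxx orbT /=.
  move=> /esym/orP[]/eqP yE /esym/orP[]/eqP xE;
    move: ab xy; rewrite xE yE ?adj_irrefl //.
  by move=> /cS ->.
have col5 f : col f < 5.
  case/edgesP: (valP f) => a [b [ab fE]].
  by rewrite (colE f a b ab fE); case: (cP a b ab).
have share (f g : edge G) x : f != g -> col f = col g -> x \in val f -> x \in val g -> False.
  move=> /eqP fg fgc xf xg; have [y xy fE] := endsP f x xf.
  have [z xz gE] := endsP g x xg.
  move: fgc; rewrite (colE f x y) // (colE g x z) // => /(cI _ _ _ xy xz) yz.
  by apply: fg; apply: val_inj; rewrite fE gE yz.
exists (fun f => inord (col f)) => f g fg /(congr1 (@nat_of_ord 5)).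
rewrite /= !inordK // => fgc; apply: dist_at_leastP => n.
case/existsP=> p /andP[]; case: n p => [|n] p.
  by rewrite (tuple0 p) /= => _ /eqP fE; rewrite fE eqxx in fg.
case/tupleP: p => h p /= /andP[/andP[fh /set0Pn[u]]].
rewrite inE => /andP[uf uh].
case: n p => [|n] p.
  by rewrite (tuple0 p) /= => _ /eqP hE; rewrite hE in uh; case: (share f g u).
case/tupleP: p => h' p /= /andP[/andP[_ /set0Pn[v]]].
rewrite inE => /andP[vh vg].
(* Walks of length at least three are harmless, since no class requires a distance above three. *)
case: n p => [|n] p; last first.
  by move=> _ _; have := col5 f; case: (col f) => [|[|[|[|[|]]]]].
rewrite (tuple0 p) /= => _ /eqP hE; rewrite {h'}hE in vg.
(* Distance two is allowed in the matching class only. *)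
case: (eqVneq (col f) 0) => [->//|f0]; exfalso.
have [a ua fE] := endsP f u uf; have [b vb gE] := endsP g v vg.
have [w uw hE] := endsP h u uh.
have /orP[/eqP vu|/eqP vw] : (v == u) || (v == w) by move: vh; rewrite hE !inE.
  by subst v; case: (share f g u).
subst w; have fc := colE f u a ua fE; have gc := colE g v b vb gE.
(* The nonzero colour of [f] lies in the palettes of both ends of the middle edge [uv], so it is the
   colour of [uv]. Injectivity at [u] and at [v] then makes both [f] and [g] equal to that edge. *)
have kE : col f = c u v.
  apply: cC => //; first by rewrite fc; case: (cP u a ua).
  by rewrite fgc gc; case: (cP v b vb).
have av : a = v by apply: (cI u) => //; rewrite -fc.
have vu : adj v u by rewrite adj_sym.
have bu : b = u by apply: (cI v) => //; rewrite -gc -fgc kE cS.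
by case: (share f g u) => //; rewrite gE bu !inE eqxx orbT.
Qed.

Theorem mainTheorem4 (G : sgraph) (subcubicG : subcubic G)
    (madG : (mad G < 9 / 4 :> rat)%R) :
  packing_edge_colorable [:: 1; 2; 2; 2; 2] G.
Proof.
have d3 (x : G) : degree x <= 3.
  by apply: leq_trans subcubicG; apply: (leq_bigmax x).
have [P [c cG]] := all_colorable d3 (mad_sparse madG) [set: G].
exact: coloring_packing cG.
Qed.
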